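(* For every $n \geq 1$ and all integers $k,\ell$, the number of sequences $\pi \in \mathcal{S}_{0012}(n)$ with $\mathrm{asc}(\pi)=k$ and $\mathrm{fwd}(\pi)=\ell$ equals the number of $132$-avoiding permutations $\sigma$ of $[n]=\{1,\dots,n\}$ with $\mathrm{asc}(\sigma)=k$ and $\mathrm{RLmax}(\sigma)=\ell$. That is, the bistatistic $(\mathrm{asc},\mathrm{fwd})$ on $\mathcal{S}_{0012}(n)$ has the same distribution as $(\mathrm{asc},\mathrm{RLmax})$ on $132$-avoiding permutations of length $n$. In particular, the number of ascents has the Narayana distribution on $\mathcal{S}_{0012}(n)$: the number of $\pi\in\mathcal{S}_{0012}(n)$ with exactly $k$ ascents is $N_{n,k+1}=\frac{1}{n}\binom{n}{k+1}\binom{n}{k}$.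
   Context: An ascent in a sequence $x_1x_2\cdots x_k$ is an index $j$ with $x_j<x_{j+1}$; $\mathrm{asc}(x)$ denotes the number of ascents of $x$. An ascent sequence of length $n$ is a sequence $x_1\cdots x_n$ of non-negative integers with $x_1=0$ and $x_i \le \mathrm{asc}(x_1\cdots x_{i-1})+1$ for $1<i\le n$. A pattern is a finite sequence $\tau=\tau_1\cdots\tau_m$ of non-negative integers; a sequence $\pi$ contains $\tau$ if there are indices $f(1)<\cdots<f(m)$ such that for all $i,j$, $\pi_{f(i)}<\pi_{f(j)}$ iff $\tau_i<\tau_j$, and $\pi_{f(i)}>\pi_{f(j)}$ iff $\tau_i>\tau_j$; otherwise $\pi$ avoids $\tau$. $\mathcal{S}_\tau(n)$ is the set of ascent sequences of length $n$ avoiding $\tau$. For an ascent sequence $x$, $\mathrm{fwd}(x)$ is the length of the maximal final (contiguous) weakly decreasing segment of $x$ (e.g. $\mathrm{fwd}(010013014364332)=5$). For a permutation $\sigma=a_1\cdots a_n$, $\mathrm{RLmax}(\sigma)$ is the number of right-to-left maxima, i.e. entries $a_i$ with $a_i>a_j$ for all $j>i$; a permutation avoids $132$ in the usual classical sense. The Narayana numbers are $N_{n,k}=\frac1n\binom nk\binom n{k-1}$. *)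

(* Defs.v *)
From mathcomp Require Import all_boot all_order all_fingroup all_algebra.

Set Implicit Arguments.
Unset Strict Implicit.
Unset Printing Implicit Defensive.

(* Words are sequences of natural numbers; positions are numbered from 0. *)

Definition asc (s : seq nat) : nat :=
  #|[set j : 'I_(size s).-1 | nth 0 s j < nth 0 s j.+1]|.

Definition is_ascent_seq (s : seq nat) : bool :=
  (nth 0 s 0 == 0) &&
  [forall i : 'I_(size s), (0 < i) ==> (nth 0 s i <= asc (take i s) + 1)].

Definition contains (s tau : seq nat) : bool :=
  [exists f : {ffun 'I_(size tau) -> 'I_(size s)},
    [forall i : 'I_(size tau), forall j : 'I_(size tau),
      (i < j) ==> (f i < f j)] &&
    [forall i : 'I_(size tau), forall j : 'I_(size tau),
      ((nth 0 s (f i) < nth 0 s (f j)) == (nth 0 tau i < nth 0 tau j)) &&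
      ((nth 0 s (f i) > nth 0 s (f j)) == (nth 0 tau i > nth 0 tau j))]].

Definition avoids (s tau : seq nat) : bool := ~~ contains s tau.

Definition fwd (s : seq nat) : nat :=
  \max_(l < (size s).+1 | sorted geq (drop (size s - l) s)) l.

Definition RLmax (s : seq nat) : nat :=
  #|[set i : 'I_(size s) |
      [forall j : 'I_(size s), (i < j) ==> (nth 0 s j < nth 0 s i)]]|.

Definition word n (x : n.-tuple 'I_n) : seq nat := [seq val i | i <- x].

(* The entries of an ascent sequence of length n are smaller than n, so taking
   the letters in 'I_n loses nothing: see [ascent_seq_word]. *)
Definition avoiding_ascent_seqs (tau : seq nat) (n : nat) :
    {set n.-tuple 'I_n} :=
  [set x | is_ascent_seq (word x) && avoids (word x) tau].

(* One-line notation with values in {1, ..., n}. *)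
Definition perm_word n (sigma : 'S_n) : seq nat :=
  [seq (val (sigma i)).+1 | i <- enum 'I_n].

Definition avoiding_perms (tau : seq nat) (n : nat) : {set 'S_n} :=
  [set sigma | avoids (perm_word sigma) tau].

(* N_{n,0} = 0, in accordance with 'C(n, -1) = 0. *)
Definition narayana (n k : nat) : rat :=
  (if k is k'.+1 then n%:R^-1 * 'C(n, k)%:R * 'C(n, k')%:R else 0)%R.

Lemma ascent_seq_bound (s : seq nat) (i : nat) :
  is_ascent_seq s -> i < size s -> nth 0 s i < size s.
Proof.
case/andP=> /eqP s0 /forallP sP lt_i; case: (posnP i) => [i0 | i_gt0].
  by rewrite i0 s0 -i0; apply: leq_ltn_trans lt_i.
have /= := sP (Ordinal lt_i); rewrite i_gt0 /= => le_i.
apply: (leq_ltn_trans _ lt_i); apply: leq_trans le_i _.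
rewrite addn1 -[leqRHS](prednK i_gt0) ltnS.
rewrite /asc; apply: leq_trans (max_card _) _.
by rewrite card_ord size_takel // ltnW.
Qed.

Lemma word_inj n : injective (@word n).
Proof. by move=> x y /(inj_map val_inj) /val_inj. Qed.

Lemma ascent_seq_word (s : seq nat) :
  is_ascent_seq s -> exists x : (size s).-tuple 'I_(size s), word x = s.
Proof.
move=> sP; exists [tuple Ordinal (ascent_seq_bound sP (ltn_ord i)) | i < size s].
apply: (@eq_from_nth _ 0) => [|i]; first by rewrite /word size_map size_tuple.
rewrite /word size_map size_tuple => lt_i.
by rewrite (nth_map (Ordinal lt_i)) ?size_tuple // -(tnth_nth _ _ (Ordinal lt_i))
  tnth_mktuple.
Qed.

(* Main.v *)
Require Import Defs.
From mathcomp Require Import all_boot all_order all_fingroup all_algebra.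
From mathcomp Require Import zify ring.

(* Both families are described by the Catalan generating tree in which a node
   (k, h) has the children (k, h+1) and (k+1, 1), ..., (k+1, h).

   Permutations: in a 132-avoiding permutation the right-to-left maxima end the
   skew components, and a last letter can be appended exactly at a cut U|D
   between components, giving (U+1) D (|D|+1). This creates an ascent unless D
   is empty, and the new number of right-to-left maxima is one more than that
   of U.

   Ascent sequences: let A_n be those of length n and B_n those not ending in 0.
   A sequence ending in 0 is a member of A_(n-1) followed by 0. A sequence of
   B_n with a single 0 is 0 followed by a member of A_(n-1) raised by 1. Any
   other member of B_n is p 0 v with v positive, and avoidance forces v to be
   weakly decreasing; deleting this last 0 gives a member pv of B_(n-1), and
   conversely 0 can be inserted before any l final letters with l <= fwd,
   giving fwd = l and a new ascent iff l < fwd. An induction turns these rules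
   into: B_n consists of the children of type (k+1, j) of A_(n-1).

   Narayana numbers: the number T of nodes (k, h) with h >= l at level n satisfies
   n T = C(n,k) (l C(n-l,k) + C(n-l,k+1)), and l = 0 gives the formula. *)

Set Implicit Arguments.
Unset Strict Implicit.
Unset Printing Implicit Defensive.

(** * Patterns as subsequences *)

(** Equality for every ordered pair [(i, j)] covers both comparisons in [contains]: exchange [i] and
    [j]. The letters selected by [f] form the subsequence [t], and a mask producing [t] gives back
    the positions. *)
Lemma containsP (s tau : seq nat) :
  reflect (exists t, [/\ subseq t s, size t = size tau &
             forall i j, i < size tau -> j < size tau ->
               (nth 0 t i < nth 0 t j) = (nth 0 tau i < nth 0 tau j)])
          (contains s tau).
Proof.
apply: (iffP existsP) => [[f /andP[/forallP f_incr /forallP f_iso]]|].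
  exists [seq nth 0 s (val (f i)) | i <- enum 'I_(size tau)].
  split; last first.
  - move=> i j lt_i lt_j.
    have nth_t k (lt_k : k < size tau) :
        nth 0 [seq nth 0 s (val (f i)) | i <- enum 'I_(size tau)] k
        = nth 0 s (f (Ordinal lt_k)).
      rewrite (@nth_map _ (Ordinal lt_k) _ 0 (fun i => nth 0 s (f i)) k
                 (enum 'I_(size tau))) ?size_enum_ord //.
      by congr (nth 0 s (f _)); apply: val_inj; rewrite /= nth_enum_ord.
    have /forallP/(_ (Ordinal lt_j))/andP[/eqP <- _] := f_iso (Ordinal lt_i).
    by rewrite !nth_t.
  - by rewrite size_map size_enum_ord.
  rewrite -[X in subseq _ X](mkseq_nth 0) /mkseq.
  rewrite (map_comp (nth 0 s) (fun i => val (f i))); apply: map_subseq.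
  (* The positions chosen by [f] increase, so their list is the sublist of [iota 0 (size s)] that it
     selects. *)
  set l := map _ _.
  have l_sorted : sorted ltn l.
    rewrite sorted_map; apply: (@sub_sorted _ (relpre val ltn)) => [i j lt_ij|].
      by have /forallP/(_ j)/implyP := f_incr i; apply.
    by rewrite -sorted_map val_enum_ord iota_ltn_sorted.
  suff -> : l = [seq i <- iota 0 (size s) | i \in l] by apply: filter_subseq.
  apply: (irr_sorted_eq ltn_trans ltnn) => // [|i].
    by rewrite sorted_filter ?iota_ltn_sorted //; apply: ltn_trans.
  rewrite mem_filter mem_iota; case: (boolP (i \in l)) => // /mapP[j _ ->].
  by rewrite ltn_ord.
case=> t [/subseqP[m sz_m t_def] sz_t t_iso].
pose idx := mask m (iota 0 (size s)).
have idxE : t = map (nth 0 s) idx.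
  by rewrite map_mask t_def -[in LHS](mkseq_nth 0 s).
have sz_idx : size idx = size tau by rewrite -sz_t idxE size_map.
have idx_lt i : i < size tau -> nth 0 idx i < size s.
  move=> lt_i; have: nth 0 idx i \in iota 0 (size s).
    by apply: (mem_subseq (mask_subseq m _)); rewrite mem_nth ?sz_idx.
  by rewrite mem_iota.
have idx_sorted : sorted ltn idx.
  exact: (subseq_sorted ltn_trans (mask_subseq _ _) (iota_ltn_sorted 0 _)).
have nth_t i : i < size tau -> nth 0 t i = nth 0 s (nth 0 idx i).
  by move=> lt_i; rewrite idxE (nth_map 0) ?sz_idx.
exists [ffun i : 'I_(size tau) => Ordinal (idx_lt i (ltn_ord i))].
apply/andP; split; apply/forallP => i; apply/forallP => j; last first.
  by rewrite !ffunE /= -!nth_t // !t_iso // !eqxx.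
apply/implyP => lt_ij; rewrite !ffunE /=.
by apply: (sorted_ltn_nth ltn_trans) => //; rewrite inE sz_idx.
Qed.

Lemma contains0012P (s : seq nat) :
  reflect (exists a b c, [/\ a < b, b < c & subseq [:: a; a; b; c] s])
          (contains s [:: 0; 0; 1; 2]).
Proof.
apply: (iffP (containsP _ _)) => [[t [sub_t sz_t iso_t]]|].
  case: t sz_t sub_t iso_t => [|a [|a' [|b [|c []]]]] //= _ sub_t iso_t.
  have := iso_t 0 1 isT isT; have := iso_t 1 0 isT isT => /= h1 h2.
  have eq_a : a' = a by lia.
  rewrite eq_a in sub_t; exists a, b, c; split=> //.
    exact: (iso_t 0 2).
  exact: (iso_t 2 3).
case=> a [b [c [lt_ab lt_bc sub_t]]]; exists [:: a; a; b; c]; split=> //.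
by case=> [|[|[|[|?]]]] [|[|[|[|?]]]] //= _ _; lia.
Qed.

Lemma contains132P (s : seq nat) :
  reflect (exists a b c, [/\ a < b, b < c & subseq [:: a; c; b] s])
          (contains s [:: 1; 3; 2]).
Proof.
apply: (iffP (containsP _ _)) => [[t [sub_t sz_t iso_t]]|].
  case: t sz_t sub_t iso_t => [|a [|c [|b []]]] //= _ sub_t iso_t.
  exists a, b, c; split=> //; first exact: (iso_t 0 2).
  exact: (iso_t 2 1).
case=> a [b [c [lt_ab lt_bc sub_t]]]; exists [:: a; c; b]; split=> //.
by case=> [|[|[|?]]] [|[|[|?]]] //= _ _; lia.
Qed.

(** * Ascents and ascent sequences, letter by letter *)

Fixpoint asc_from (p : nat) (s : seq nat) : nat :=
  if s is x :: s' then (p < x) + asc_from x s' else 0.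

Lemma asc_cons x s : asc (x :: s) = asc_from x s.
Proof.
rewrite /asc /= -sum1dep_card big_mkcond /=.
elim: s x => [|y s IHs] x; first by rewrite big_ord0.
by rewrite /= big_ord_recl /= -IHs; case: ltnP.
Qed.

Lemma asc_from_cat p s t :
  asc_from p (s ++ t) = asc_from p s + asc_from (last p s) t.
Proof. by elim: s p => //= x s IHs p; rewrite IHs addnA. Qed.

Lemma asc_from_mapS p s : asc_from p.+1 (map S s) = asc_from p s.
Proof. by elim: s p => //= x s IHs p; rewrite IHs. Qed.

(* The letters s may follow an ascent sequence with a ascents and last letter p. *)
Fixpoint asc_ok (a p : nat) (s : seq nat) : bool :=
  if s is x :: s' then (x <= a.+1) && asc_ok (a + (p < x)) x s' else true.

Lemma asc_ok_cat a p s t :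
  asc_ok a p (s ++ t) =
    asc_ok a p s && asc_ok (a + asc_from p s) (last p s) t.
Proof.
elim: s a p => [|x s IHs] a p /=; first by rewrite addn0.
by rewrite IHs andbA addnA.
Qed.

Lemma asc_ok_mapS a p s : asc_ok a.+1 p.+1 (map S s) = asc_ok a p s.
Proof. by elim: s a p => //= x s IHs a p; rewrite addSn IHs. Qed.

Lemma asc_okP a p s :
  reflect (forall i, i < size s -> nth 0 s i <= a + asc_from p (take i s) + 1)
          (asc_ok a p s).
Proof.
elim: s a p => [|x s IHs] a p /=; first by constructor.
apply: (iffP andP) => [[le_x /IHs s_ok] [|i] //= lt_i|s_ok].
- by rewrite addn0 addn1.
- by rewrite addnA; apply: s_ok.
split; first by have := s_ok 0 isT; rewrite /= addn0 addn1.
by apply/IHs => i lt_i; have := s_ok i.+1 lt_i; rewrite /= addnA.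
Qed.

Lemma is_ascent_seq_cons x s : is_ascent_seq (x :: s) = (x == 0) && asc_ok 0 x s.
Proof.
rewrite /is_ascent_seq /=; congr (_ && _); apply/forallP/asc_okP => /= s_ok i.
  move=> lt_i; have /= := s_ok (Ordinal (lt_i : i.+1 < (size s).+1)).
  by rewrite asc_cons.
apply/implyP; case: i => [[|i] lt_i] //= _.
by rewrite asc_cons; apply: s_ok.
Qed.

(** Along a weakly decreasing run the number of ascents, hence the bound, stays fixed while the
    letters never grow. *)
Lemma asc_ok_weak_decr a y s : sorted geq (y :: s) -> y <= a.+1 -> asc_ok a y s.
Proof.
elim: s y => //= x s IHs y /andP[le_xy s_sorted] le_y.
rewrite /geq /= in le_xy.
by rewrite (leq_trans le_xy) // ltnNge le_xy addn0 IHs // (leq_trans le_xy).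
Qed.

(** * Subsequences and weakly decreasing words *)

Lemma subseq_rcons_neq (T : eqType) (t s : seq T) c x :
  c != x -> subseq (rcons t c) (rcons s x) -> subseq (rcons t c) s.
Proof.
move=> neq_cx; rewrite -subseq_rev !rev_rcons /= (negPf neq_cx).
by rewrite -rev_rcons subseq_rev.
Qed.

Lemma subseq_catP (T : eqType) (t s1 s2 : seq T) :
  subseq t (s1 ++ s2) ->
  exists t1 t2, [/\ t = t1 ++ t2, subseq t1 s1 & subseq t2 s2].
Proof.
case/subseqP=> m sz_m ->; rewrite size_cat in sz_m.
have sz_take : size (take (size s1) m) = size s1 by rewrite size_takel ?sz_m ?leq_addr.
exists (mask (take (size s1) m) s1), (mask (drop (size s1) m) s2).
by rewrite -[in LHS](cat_take_drop (size s1) m) mask_cat // !mask_subseq.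
Qed.

Lemma last_split (T : eqType) (x : T) s :
  x \in s -> exists p v, s = p ++ x :: v /\ x \notin v.
Proof.
elim/last_ind: s => // s y IHs; rewrite mem_rcons inE.
case: (eqVneq x y) => [<- _|neq_xy /= /IHs[p [v [-> x_v]]]].
  by exists s, [::]; rewrite cats1.
exists p, (rcons v y); rewrite rcons_cat; split=> //.
by rewrite mem_rcons inE negb_or neq_xy.
Qed.

Lemma geq_trans : transitive geq.
Proof. by move=> y x z le_yx le_zy; apply: leq_trans le_zy le_yx. Qed.

Lemma sorted_geq_subseq2 v :
  (forall b c, subseq [:: b; c] v -> c <= b) <-> sorted geq v.
Proof.
rewrite (sorted_pairwise geq_trans); split=> [|v_dec b c /subseq_pairwise/(_ v_dec)].
  elim: v => //= x v IHv hv; apply/andP; split.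
    apply/allP => y y_v; apply: hv; rewrite eqxx.
    by rewrite sub1seq.
  apply: IHv => b c sub_bc; apply: hv.
  exact: (subseq_trans sub_bc (subseq_cons v x)).
by rewrite /= andbT => /andP[].
Qed.

(** * The final weakly decreasing segment *)

Lemma fwd_le_size s : fwd s <= size s.
Proof. by apply/bigmax_leqP => i _; rewrite -ltnS. Qed.

(** Suffixes of weakly decreasing words are weakly decreasing, so the maximum defining [fwd] is a
    threshold. The later computations of [fwd] test this threshold. *)
Lemma leq_fwd l s :
  l <= size s -> (l <= fwd s) = sorted geq (drop (size s - l) s).
Proof.
move=> le_l; apply/idP/idP => [le_lf|l_sorted]; last first.
  by apply: (leq_bigmax_cond (Ordinal (le_l : l < (size s).+1))).
have [|i] := @eq_bigmax_cond _
  [pred i : 'I_(size s).+1 | sorted geq (drop (size s - i) s)] (fun i => val i).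
  by apply/card_gt0P; exists ord0; rewrite inE subn0 drop_size.
rewrite inE => i_sorted fwdE.
have {}fwdE : fwd s = i by rewrite -fwdE; apply: eq_bigl => j; rewrite inE.
rewrite fwdE in le_lf; have lt_i := ltn_ord i.
have -> : size s - l = (i - l) + (size s - i) by lia.
by rewrite -drop_drop; apply: drop_sorted.
Qed.

(** A final 0 lengthens every weakly decreasing suffix by one letter. *)
Lemma fwd_rcons0 s : fwd (rcons s 0) = (fwd s).+1.
Proof.
have fwdS l : l <= size s -> (l.+1 <= fwd (rcons s 0)) = (l <= fwd s).
  move=> le_l; rewrite !leq_fwd ?size_rcons // subSS drop_rcons ?leq_subr //.
  case: (drop _ s) => // x t; rewrite /= rcons_path.
  by rewrite /geq /= leq0n andbT.
have := fwd_le_size s; have := fwd_le_size (rcons s 0); rewrite size_rcons.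
have := fwdS (fwd s) (fwd_le_size s); rewrite leqnn => h.
case: (ltnP (fwd s) (size s)) => [lt_f|]; last by lia.
have := fwdS (fwd s).+1 lt_f; lia.
Qed.

Lemma fwd_split p x y v :
  x < y -> sorted geq (y :: v) -> fwd (rcons p x ++ y :: v) = (size v).+1.
Proof.
move=> lt_xy v_sorted; set s := _ ++ _.
have sz_s : size s = (size p + (size v).+2) by rewrite size_cat size_rcons /=; lia.
apply/eqP; rewrite eqn_leq leq_fwd; last by rewrite sz_s; lia.
have -> : drop (size s - (size v).+1) s = y :: v.
  by rewrite sz_s drop_size_cat // size_rcons; lia.
rewrite v_sorted andbT leqNgt leq_fwd; last by rewrite sz_s; lia.
have -> : drop (size s - (size v).+2) s = x :: y :: v.
  by rewrite sz_s /s cat_rcons drop_size_cat //; lia.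
by rewrite /= /geq /= leqNgt lt_xy.
Qed.

(** Raising all letters preserves their order, and the leading 0, smaller than the letter after it,
    never joins the final run. *)
Lemma fwd_shift x s : fwd (0 :: map S (x :: s)) = fwd (x :: s).
Proof.
have sortedS t : sorted geq (map S t) = sorted geq t by rewrite sorted_map.
have: 0 < size (x :: s) by []; move: (x :: s) => t t_gt0.
have sz_t : size (0 :: map S t) = (size t).+1 by rewrite /= size_map.
have fwdE l : l <= size t -> (l <= fwd (0 :: map S t)) = (l <= fwd t).
  move=> le_l; rewrite [RHS]leq_fwd // leq_fwd sz_t; last by lia.
  by rewrite subSn //= -map_drop sortedS.
have le_f := fwd_le_size t; have := fwdE _ le_f; rewrite leqnn => le_ff.
have ntop : ~~ ((size t).+1 <= fwd (0 :: map S t)).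
  rewrite leq_fwd sz_t // subnn drop0.
  by case: (t) t_gt0.
have lt_f : fwd (0 :: map S t) <= size t by rewrite leqNgt.
by have := fwdE _ lt_f; lia.
Qed.

(** * Appending, prefixing and inserting a 0 *)

Lemma contains0012_rcons0 s :
  contains (rcons s 0) [:: 0; 0; 1; 2] = contains s [:: 0; 0; 1; 2].
Proof.
apply/contains0012P/contains0012P => -[a [b [c [lt_ab lt_bc sub_s]]]];
  exists a, b, c; split=> //.
  by apply: (@subseq_rcons_neq _ [:: a; a; b] _ _ 0) => //; lia.
by apply: subseq_trans sub_s (subseq_rcons _ _).
Qed.

(** The leading 0 is the only 0 of the word, whereas the smallest letter of an occurrence appears
    twice. *)
Lemma contains0012_shift s :
  contains (0 :: map S s) [:: 0; 0; 1; 2] = contains s [:: 0; 0; 1; 2].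
Proof.
apply/contains0012P/contains0012P => -[a [b [c [lt_ab lt_bc sub_s]]]].
  have a_gt0 : 0 < a.
    rewrite lt0n; apply: contraTneq sub_s => -> /=.
    apply/negP => /mem_subseq/(_ 0); rewrite inE eqxx => /(_ isT) /mapP[].
    by [].
  exists a.-1, b.-1, c.-1; split; [lia|lia|].
  have {}sub_s : subseq [:: a; a; b; c] (map S s).
    by move: sub_s; rewrite /= (gtn_eqF a_gt0).
  by have := map_subseq predn sub_s; rewrite -map_comp map_id.
exists a.+1, b.+1, c.+1; split=> //.
exact: (map_subseq S sub_s).
Qed.

(** In an occurrence the new 0 could only be one of the two smallest letters; the two largest would
    then form an ascending pair inside [v]. *)
Lemma contains0012_insert p v :
  sorted geq v -> 0 \notin v ->
  contains (p ++ 0 :: v) [:: 0; 0; 1; 2] = contains (p ++ v) [:: 0; 0; 1; 2].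
Proof.
move=> v_sorted v_pos.
apply/contains0012P/contains0012P => -[a [b [c [lt_ab lt_bc sub_s]]]];
  exists a, b, c; split=> //; last first.
  by apply: subseq_trans sub_s _; apply: cat_subseq => //; apply: subseq_cons.
have [t1 [t2 [def_t sub_t1 sub_t2]]] := subseq_catP sub_s.
have nsub_bc : ~~ subseq [:: b; c] v.
  apply/negP => sub_bc; have := (sorted_geq_subseq2 v).2 v_sorted _ _ sub_bc; lia.
have {}sub_t2 : subseq t2 v.
  case: t2 def_t sub_t2 => [|d t2] def_t; first by rewrite !sub0seq.
  rewrite [subseq _ (0 :: v)]/=; case: eqVneq => [d0 sub_t2|_ //].
  rewrite d0 in def_t.
  (* The number of letters of the occurrence taken from [p] tells which of [a, a, b, c] the new 0
     is. *)
  case: t1 def_t {sub_t1} => [|e1 [|e2 [|e3 [|e4 t1]]]] /=.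
  - case=> a0 def_t2; rewrite -def_t2 in sub_t2.
    case/negP: nsub_bc; apply: subseq_trans sub_t2; exact: subseq_cons.
  - by case=> _ _ def_t2; rewrite -def_t2 in sub_t2; rewrite sub_t2 in nsub_bc.
  - by case=> _ _ b0; lia.
  - by case=> _ _ _ c0; lia.
  - by case: t1.
by rewrite def_t; apply: cat_subseq.
Qed.

Lemma is_ascent_seq_rcons0 x s :
  is_ascent_seq (rcons (x :: s) 0) = is_ascent_seq (x :: s).
Proof.
by rewrite rcons_cons !is_ascent_seq_cons -cats1 asc_ok_cat /= andbT.
Qed.

Lemma is_ascent_seq_shift x s :
  is_ascent_seq (0 :: map S (x :: s)) = is_ascent_seq (x :: s).
Proof.
rewrite !is_ascent_seq_cons /= ltnS leqn0.
by case: eqP => // ->; rewrite (asc_ok_mapS 0 0).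
Qed.

(** The new 0 leaves the bound for the first letter of [v] unchanged, and the rest of [v] decreases
    weakly from there, hence is always allowed. *)
Lemma is_ascent_seq_insert x p v :
  sorted geq v -> 0 \notin v ->
  is_ascent_seq (x :: p ++ 0 :: v) = is_ascent_seq (x :: p ++ v).
Proof.
case: v => [|y v] v_sorted v_pos.
  by rewrite cats0 cats1 -rcons_cons is_ascent_seq_rcons0.
rewrite !is_ascent_seq_cons !asc_ok_cat; congr (_ && (_ && _)) => /=.
rewrite addn0; case: (leqP y (0 + asc_from x p).+1) => //= le_y.
by rewrite !asc_ok_weak_decr //; lia.
Qed.

Lemma asc_rcons0 s : asc (rcons s 0) = asc s.
Proof.
case: s => [|x s]; first by rewrite /asc /= !eq_card0 // => -[].
by rewrite rcons_cons !asc_cons -cats1 asc_from_cat /= !addn0.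
Qed.

Lemma asc_shift x s : asc (0 :: map S (x :: s)) = (asc (x :: s)).+1.
Proof. by rewrite !asc_cons /= asc_from_mapS add1n. Qed.

(** The new ascent from 0 to [y] replaces the ascent into [y] if there was one, and is a gain
    otherwise. *)
Lemma asc_insert x p y v :
  0 < y ->
  asc (x :: p ++ 0 :: y :: v) = asc (x :: p ++ y :: v) + (y <= last x p).
Proof.
by move=> y_gt0; rewrite !asc_cons !asc_from_cat /= y_gt0; case: leqP; lia.
Qed.

(** * The generating tree and ascent sequences *)

Definition ascending_children (kh : nat * nat) : seq (nat * nat) :=
  [seq (kh.1.+1, j) | j <- iota 1 kh.2].

(** Level [n] of the tree, as a list with multiplicities. It belongs to words of length [n + 1], the
    root being the word of length one. *)
Fixpoint catalan_tree (n : nat) : seq (nat * nat) :=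
  if n is m.+1 then
    flatten [seq (kh.1, kh.2.+1) :: ascending_children kh | kh <- catalan_tree m]
  else [:: (0, 1)].

Lemma count_big (T : Type) (a : pred T) s : count a s = \sum_(x <- s) a x.
Proof. by rewrite -sum1_count big_mkcond; apply: eq_bigr => x _; case: (a x). Qed.

Lemma count_flatten_map (T U : Type) (a : pred U) (f : T -> seq U) s :
  count a (flatten (map f s)) = \sum_(x <- s) count a (f x).
Proof. by rewrite count_flatten -map_comp sumnE big_map. Qed.

Lemma perm_flatten_map (T U : eqType) (f : T -> seq U) s t :
  perm_eq s t -> perm_eq (flatten (map f s)) (flatten (map f t)).
Proof.
by move=> eq_st; apply/seq.permP => a; rewrite !count_flatten_map (perm_big _ eq_st).
Qed.

Lemma sorted_geq_last s x : sorted geq s -> x \in s -> last 0 s <= x.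
Proof.
case/lastP: s => // s y; rewrite (sorted_pairwise geq_trans) pairwise_rcons.
rewrite last_rcons mem_rcons inE => /andP[/allP s_ge _] /orP[/eqP-> //|].
exact: s_ge.
Qed.

Lemma fwd_gt0 x s : 0 < fwd (x :: s).
Proof.
rewrite leq_fwd // subn1 [size _]/= [_.-1]/= lastI.
by rewrite -cats1 drop_size_cat // size_belast.
Qed.

Definition insert0 (s : seq nat) (l : nat) : seq nat :=
  take (size s - l) s ++ 0 :: drop (size s - l) s.

Lemma insert0_cat p v : insert0 (p ++ v) (size v) = p ++ 0 :: v.
Proof. by rewrite /insert0 size_cat addnK take_size_cat // drop_size_cat. Qed.

(** The last letter is the smallest of a weakly decreasing suffix, so such a suffix is positive. It
    therefore misses the initial 0, which is left in front. *)
Lemma final_segment s l :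
  is_ascent_seq s -> last 0 s != 0 -> 0 < l <= fwd s ->
  exists p y v, [/\ s = 0 :: p ++ y :: v, (size v).+1 = l,
                    sorted geq (y :: v) & 0 \notin y :: v].
Proof.
move=> s_asc s_last /andP[l_gt0 le_l].
have le_lsz := leq_trans le_l (fwd_le_size s).
move: le_l; rewrite leq_fwd //; set v := drop _ s => v_sorted.
have sz_v : size v = l by rewrite size_drop subKn.
have last_v : last 0 v = last 0 s.
  rewrite -(cat_take_drop (size s - l) s) last_cat -/v.
  by case: (v) sz_v => //= l0; rewrite -l0 in l_gt0.
have v_pos : 0 \notin v.
  apply/negP => /(sorted_geq_last v_sorted).
  by rewrite last_v leqn0 (negPf s_last).
have := cat_take_drop (size s - l) s; rewrite -/v.
case: (take _ s) => [|x p] def_s.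
  rewrite -def_s /= in s_asc s_last v_pos.
  case: (v) v_pos s_asc sz_v => [|y t]; first by move=> _ _ /= l0; rewrite -l0 in l_gt0.
  by rewrite is_ascent_seq_cons => /negP v0 /andP[/eqP y0 _]; case: v0; rewrite inE y0.
have x0 : x = 0.
  by move: s_asc; rewrite -def_s is_ascent_seq_cons => /andP[/eqP].
case def_v: v sz_v => [|y t] sz_v; first by rewrite -sz_v in l_gt0.
by exists p, y, t; rewrite -def_v -def_s x0.
Qed.

(** The final run reaches beyond [y :: v] exactly when the letter before [y] is at least [y]. *)
Lemma leq_last_fwd x p y v :
  sorted geq (y :: v) ->
  (y <= last x p) = ((size v).+1 < fwd (x :: p ++ y :: v)).
Proof.
move=> v_sorted; rewrite -cat_cons (lastI x p).
case: (leqP y (last x p)) => [le_y|lt_y]; last by rewrite fwd_split // ltnn.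
rewrite leq_fwd size_cat size_rcons /=; last by lia.
by rewrite cat_rcons drop_size_cat; [apply/esym/andP; split | lia].
Qed.

Definition asc_fwd (s : seq nat) := (asc s, fwd s).

Lemma asc_fwd_insert0 s l :
  is_ascent_seq s -> last 0 s != 0 -> 0 < l <= fwd s ->
  asc_fwd (insert0 s l) = (asc s + (l < fwd s), l).
Proof.
move=> s_asc s_last le_l.
have [p [y [v [-> <- v_sorted v_pos]]]] := final_segment s_asc s_last le_l.
have y_gt0 : 0 < y by move: v_pos; rewrite inE negb_or eq_sym lt0n => /andP[].
rewrite -cat_cons (insert0_cat (0 :: p) (y :: v)) /asc_fwd asc_insert //.
by rewrite -leq_last_fwd // -(cat_rcons 0 (0 :: p)) fwd_split.
Qed.

(* The index is shifted by one: these sequences have length n + 1. *)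
Definition ascent0012 (n : nat) (s : seq nat) : bool :=
  [&& size s == n.+1, is_ascent_seq s & avoids s [:: 0; 0; 1; 2]].

Lemma ascent0012_rcons0 n s : ascent0012 n.+1 (rcons s 0) = ascent0012 n s.
Proof.
rewrite /ascent0012 size_rcons eqSS /avoids contains0012_rcons0.
by case: s => // x s; rewrite is_ascent_seq_rcons0.
Qed.

Lemma ascent0012_shift n s : ascent0012 n.+1 (0 :: map S s) = ascent0012 n s.
Proof.
rewrite /ascent0012 /= size_map eqSS /avoids contains0012_shift.
by case: s => // x s; rewrite is_ascent_seq_shift.
Qed.

Lemma ascent0012_insert n x p v :
  sorted geq v -> 0 \notin v ->
  ascent0012 n.+1 (x :: p ++ 0 :: v) = ascent0012 n (x :: p ++ v).
Proof.
move=> v_sorted v_pos; rewrite /ascent0012 is_ascent_seq_insert // /avoids.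
rewrite -!cat_cons contains0012_insert //; congr (_ && _).
by rewrite !size_cat /= addnS.
Qed.

(** The two components enumerate the sets A and B of the overview, for length [n + 1]. *)
Fixpoint ascent0012_lists (n : nat) : seq (seq nat) * seq (seq nat) :=
  if n is m.+1 then
    let: (A, B) := ascent0012_lists m in
    let B' := [seq 0 :: map S s | s <- A] ++
              [seq insert0 s l | s <- B, l <- iota 1 (fwd s)] in
    ([seq rcons s 0 | s <- A] ++ B', B')
  else ([:: [:: 0]], [::]).

Lemma mem_ascent0012_lists n s :
  (s \in (ascent0012_lists n).1) = ascent0012 n s /\
  (s \in (ascent0012_lists n).2) = ascent0012 n s && (last 0 s != 0).
Proof.
elim: n s => [|n IHn] s.
  have seq1 : (s == [:: 0]) = ascent0012 0 s.
    case: s => [|x [|y s]] //; last by rewrite eqseq_cons andbF.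
    rewrite /ascent0012 is_ascent_seq_cons /= eqseq_cons !andbT.
    case: eqP => //= ->; apply/esym/contains0012P => -[a [b [c [_ _]]]].
    by move/size_subseq.
  rewrite /= inE in_nil seq1; split=> //.
  by rewrite -seq1; case: eqP => // ->.
move: IHn => /=; case: (ascent0012_lists n) => A B /= IHn.
have memB : (s \in [seq 0 :: map S s | s <- A] ++
              [seq insert0 s l | s <- B, l <- iota 1 (fwd s)]) =
            ascent0012 n.+1 s && (last 0 s != 0).
  rewrite mem_cat; apply/orP/andP => [[/mapP[t]|/allpairsPdep[t [l]]]|].
  - rewrite (IHn t).1 => t_good ->; rewrite ascent0012_shift; split=> //.
    by case: t t_good => //= x t _; rewrite last_map.
  - rewrite (IHn t).2 mem_iota add1n ltnS => -[/andP[t_good t_last] le_l ->].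
    have /and3P[_ t_asc _] := t_good.
    have [p [y [v [def_t <- v_sorted v_pos]]]] := final_segment t_asc t_last le_l.
    rewrite def_t -cat_cons (insert0_cat (0 :: p) (y :: v)) /=.
    rewrite ascent0012_insert // -def_t; split=> //.
    by move: t_last; rewrite def_t /= !last_cat.
  case=> s_good s_last.
  case: s s_good s_last => [|x s] s_good s_last //.
  have /and3P[sz_s s_asc s_av] := s_good.
  have x0 : x = 0 by move: s_asc; rewrite is_ascent_seq_cons => /andP[/eqP].
  rewrite {}x0 in s_good s_last s_asc s_av *.
  (* Without a second 0 the word is a raised one behind 0; otherwise it is cut at its last 0. *)
  case: (boolP (0 \in s)) => [/last_split[p [v [def_s v_pos]]]|s_pos]; last first.
    left; have def_s : s = map S (map predn s).
      rewrite -map_comp -[LHS]map_id; apply/eq_in_map => z z_s /=.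
      by rewrite prednK // lt0n; apply: contraNneq s_pos => <-.
    apply/mapP; exists (map predn s); last by rewrite -def_s.
    by rewrite (IHn _).1 -ascent0012_shift -def_s.
  right; apply/allpairsPdep.
  (* The initial 0, the last 0 and an ascending pair of letters of [v] would form the pattern
     0012. *)
  have v_sorted : sorted geq v.
    apply/sorted_geq_subseq2 => b c sub_bc; rewrite leqNgt.
    apply: contra s_av => lt_bc; apply/contains0012P; exists 0, b, c; split=> //.
      rewrite lt0n; apply: contraNneq v_pos => <-.
      by rewrite (mem_subseq sub_bc) // inE eqxx.
    rewrite def_s /= -[_ :: _ :: _]/([::] ++ [:: 0, b & [:: c]]).
    by apply: cat_subseq; [apply: sub0seq | rewrite /=].
  case: v def_s v_pos v_sorted => [|y v] def_s v_pos v_sorted.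
    by rewrite def_s /= last_cat in s_last.
  have pv_good : ascent0012 n (0 :: p ++ y :: v).
    by rewrite -ascent0012_insert // -def_s.
  exists (0 :: p ++ y :: v), (size v).+1; split.
  - rewrite (IHn _).2 pv_good /=.
    by move: s_last; rewrite def_s /= !last_cat.
  - rewrite mem_iota; apply/andP; split=> //.
    rewrite add1n ltnS leq_fwd; last by rewrite /= size_cat /=; lia.
    by rewrite -cat_cons size_cat addnK drop_size_cat.
  - by rewrite -cat_cons (insert0_cat (0 :: p) (y :: v)) def_s.
split; rewrite ?memB // mem_cat memB.
case: (eqVneq (last 0 s) 0) => [last0|last_pos] /=; last first.
  rewrite andbT; case: mapP => // -[t _ def_s].
  by rewrite def_s last_rcons in last_pos.
rewrite andbF orbF; apply/mapP/idP => [[t t_A ->]|s_good].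
  by rewrite ascent0012_rcons0 -(IHn t).1.
case/lastP: s last0 s_good {memB} => // s x; rewrite last_rcons => -> s_good.
by exists s; rewrite // (IHn _).1 -ascent0012_rcons0.
Qed.

(** The inserted 0 is the last 0 of the result, so its position gives back [l], and deleting it
    gives back the word. The three families are told apart by their last letter and by whether a
    second 0 occurs. *)
Lemma ascent0012_lists_uniq n :
  uniq (ascent0012_lists n).1 && uniq (ascent0012_lists n).2.
Proof.
elim: n => [|n] //=; have := mem_ascent0012_lists n.+1.
have := mem_ascent0012_lists n => /=.
case: (ascent0012_lists n) => A B /= memAB memAB' /andP[A_uniq B_uniq].
set B' := map (fun s => 0 :: map S s) A ++ _ in memAB' *.
have insE t l : t \in B -> l \in iota 1 (fwd t) ->
    exists p v, [/\ insert0 t l = 0 :: p ++ 0 :: v, t = 0 :: p ++ v,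
                    size v = l & 0 \notin v].
  rewrite (memAB t).2 mem_iota add1n ltnS => /andP[/and3P[_ t_asc _] t_last] le_l.
  have [p [y [v [def_t <- _ v_pos]]]] := final_segment t_asc t_last le_l.
  exists p, (y :: v); split=> //.
  by rewrite def_t -cat_cons (insert0_cat (0 :: p) (y :: v)).
have B'_uniq : uniq B'.
  rewrite cat_uniq map_inj_uniq ?A_uniq //=; last first.
    by move=> s t [] eq_st; apply: (inj_map succn_inj).
  apply/andP; split.
    apply/hasPn => _ /allpairsPdep[t [l [t_B l_t ->]]].
    have [p [v [-> _ _ _]]] := insE t l t_B l_t.
    apply/mapP => -[s _ [def_s]].
    have : 0 \in map S s by rewrite -def_s mem_cat inE eqxx orbT.
    by case/mapP.
  apply: allpairs_uniq_dep => // [t _|]; first exact: iota_uniq.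
  move=> x1 x2 /allpairsPdep[t1 [l1 [t1_B l1_t ->]]].
  case/allpairsPdep=> [t2 [l2 [t2_B l2_t ->]]] /=.
  have [p1 [v1 [-> def_t1 <- v1_pos]]] := insE _ _ t1_B l1_t.
  have [p2 [v2 [-> def_t2 <- v2_pos]]] := insE _ _ t2_B l2_t.
  case=> eq_ins.
  (* Reading from the right, the first 0 met is the inserted one. *)
  have idx p v : 0 \notin v -> index 0 (rev (p ++ 0 :: v)) = size v.
    move=> v_pos; rewrite rev_cat rev_cons -cats1 -catA index_cat mem_rev.
    by rewrite (negPf v_pos) size_rev addn0.
  have sz_v : size v1 = size v2 by rewrite -(idx p1) // eq_ins idx.
  have sz_p : size p1 = size p2.
    by have := congr1 size eq_ins; rewrite !size_cat /=; lia.
  move/eqP: eq_ins; rewrite eqseq_cat // eqseq_cons.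
  case/andP=> /eqP eq_p /= /eqP eq_v.
  by rewrite def_t1 def_t2 eq_p eq_v.
rewrite cat_uniq B'_uniq map_inj_uniq ?A_uniq ?andbT //=; last first.
  by move=> s t /rcons_inj[].
apply/hasPn => s; rewrite (memAB' s).2 => /andP[_ s_last].
by apply/mapP => -[t _ def_s]; rewrite def_s last_rcons in s_last.
Qed.

(** From here on only the multisets of labels matter. Positivity of [fwd] allows the final-run
    length to be written as a successor later. *)
Lemma asc_fwd_ascent0012_lists n :
  let A := map asc_fwd (ascent0012_lists n).1 in
  let B := map asc_fwd (ascent0012_lists n).2 in
  [/\ all (fun kh => 0 < kh.2) A, all (fun kh => 0 < kh.2) B,
    map asc_fwd (ascent0012_lists n.+1).1 =
      [seq (kh.1, kh.2.+1) | kh <- A] ++ map asc_fwd (ascent0012_lists n.+1).2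
  & map asc_fwd (ascent0012_lists n.+1).2 =
      [seq (kh.1.+1, kh.2) | kh <- A] ++
      flatten [seq [seq (kh.1 + (l < kh.2), l) | l <- iota 1 kh.2] | kh <- B]].
Proof.
have := mem_ascent0012_lists n => /=.
case: (ascent0012_lists n) => A B /= memAB; split.
- apply/allP => kh /mapP[s]; rewrite (memAB s).1 => s_good -> /=.
  by case: s s_good => // x s _; apply: fwd_gt0.
- apply/allP => kh /mapP[s]; rewrite (memAB s).2 => /andP[s_good _] -> /=.
  by case: s s_good => // x s _; apply: fwd_gt0.
- rewrite !map_cat; congr (_ ++ _); rewrite -!map_comp; apply: eq_map => s /=.
  by rewrite /asc_fwd asc_rcons0 fwd_rcons0.
rewrite map_cat; congr (_ ++ _).
  rewrite -!map_comp; apply/eq_in_map => s; rewrite (memAB s).1.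
  by case: s => // x s _ /=; rewrite /asc_fwd asc_shift fwd_shift.
rewrite map_flatten -!map_comp; congr flatten; apply/eq_in_map => s.
rewrite (memAB s).2 => /andP[/and3P[_ s_asc _] s_last] /=.
rewrite -map_comp; apply/eq_in_map => l; rewrite mem_iota add1n ltnS => le_l /=.
by rewrite asc_fwd_insert0.
Qed.

Lemma iota1S n : iota 1 n.+1 = iota 1 n ++ [:: n.+1].
Proof. by have := iotaD 1 n 1; rewrite addn1. Qed.

Lemma count_ascending_children a k h :
  count a (ascending_children (k, h.+1)) =
    count a (ascending_children (k, h)) + a (k.+1, h.+1).
Proof.
by rewrite /ascending_children [(_, _).2]/= iota1S map_cat count_cat /= addn0.
Qed.

(** This is the induction that matches the insertion rule, which applies to B only, with the tree
    rule, which applies to all of A. *)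
Lemma perm_asc_fwd_final_pos n :
  perm_eq (map asc_fwd (ascent0012_lists n.+1).2)
    (flatten [seq ascending_children kh | kh <- map asc_fwd (ascent0012_lists n).1]).
Proof.
elim: n => [|n IHn].
  have [_ _ _ ->] := asc_fwd_ascent0012_lists 0.
  rewrite /= /asc_fwd; have := fwd_rcons0 [::]; rewrite /= => ->.
  have -> : fwd [::] = 0 by apply/eqP; rewrite -leqn0 fwd_le_size.
  by [].
have [A_pos B_pos _ defB] := asc_fwd_ascent0012_lists n.+1.
have [_ _ defA _] := asc_fwd_ascent0012_lists n.
apply/seq.permP => a; rewrite {}defB count_cat count_map count_flatten_map.
move: A_pos B_pos IHn; rewrite {}defA.
set A := map asc_fwd _; set B := map asc_fwd _ => A_pos B_pos /seq.permP/(_ a) IHn.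
(* [prev] leaves out the top child [(k+1, h)]. Insertions into a word of B labelled [(k, h)] produce
   the children counted by [prev] when [l < h], and [(k, h)] itself when [l = h]. *)
pose prev (kh : nat * nat) := count a (ascending_children (kh.1, kh.2.-1)).
have -> : \sum_(kh <- B) count a [seq (kh.1 + (l < kh.2), l) | l <- iota 1 kh.2]
          = count a B + \sum_(kh <- B) prev kh.
  rewrite (count_big a B) -big_split; apply: eq_big_seq => -[k [|h]] /(allP B_pos) // _.
  rewrite /prev [(k, h.+1).1]/= [(k, h.+1).2]/= [h.+1.-1]/=.
  rewrite iota1S map_cat count_cat [count a (map _ [:: _])]/= !addn0 ltnn addn0 addnC.
  congr (_ + _).
  congr (count a _); apply/eq_in_map => l; rewrite mem_iota add1n => /andP[_ ->].
  by rewrite addn1.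
have upE s : all (fun kh => 0 < kh.2) s ->
    \sum_(kh <- s) count a (ascending_children kh) =
    count (fun kh => a (kh.1.+1, kh.2)) s + \sum_(kh <- s) prev kh.
  move=> s_pos; rewrite (count_big _ s) -big_split.
  apply: eq_big_seq => -[k [|h]] /(allP s_pos) // _.
  by rewrite count_ascending_children addnC.
(* The top children come from the shifted words. Words of A ending in 0 have labels [(k, h+1)], for
   which [prev] counts all ascending children of [(k, h)]; by induction these make up B. *)
rewrite count_flatten_map upE // IHn count_flatten_map; congr (_ + _).
by rewrite big_cat big_map.
Qed.

Lemma perm_asc_fwd_catalan_tree n :
  perm_eq (map asc_fwd (ascent0012_lists n).1) (catalan_tree n).
Proof.
elim: n => [|n IHn].
  rewrite /= /asc_fwd; have := fwd_rcons0 [::]; rewrite /= => ->.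
  have -> : fwd [::] = 0 by apply/eqP; rewrite -leqn0 fwd_le_size.
  by rewrite asc_cons.
have [_ _ -> _] := asc_fwd_ascent0012_lists n.
rewrite /=; apply: perm_trans (perm_flatten_map _ IHn).
apply/seq.permP => a; rewrite count_cat (seq.permP (perm_asc_fwd_final_pos n)).
rewrite !count_flatten_map count_big.
by move: (map asc_fwd _) => A; rewrite big_map -big_split.
Qed.

(** * Permutations avoiding 132 *)

Lemma contains132_mapS s :
  contains (map S s) [:: 1; 3; 2] = contains s [:: 1; 3; 2].
Proof.
apply/contains132P/contains132P => -[a [b [c [lt_ab lt_bc sub_s]]]].
  have a_gt0 : 0 < a.
    have /mapP[x _ ->] : a \in map S s by rewrite (mem_subseq sub_s) // inE eqxx.
    by [].
  exists a.-1, b.-1, c.-1; split; [lia|lia|].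
  by have := map_subseq predn sub_s; rewrite -map_comp map_id.
exists a.+1, b.+1, c.+1; split=> //.
exact: (map_subseq S sub_s).
Qed.

(** An occurrence meeting both blocks has its first letter in [U] and its last, larger letter in
    [D], which is impossible. *)
Lemma contains132_skew U D :
  allrel gtn U D ->
  contains (U ++ D) [:: 1; 3; 2] =
    contains U [:: 1; 3; 2] || contains D [:: 1; 3; 2].
Proof.
move/allrelP => gt_UD; apply/idP/orP => [/contains132P|].
  case=> a [b [c [lt_ab lt_bc /subseq_catP[t1 [t2 [def_t sub1 sub2]]]]]].
  case: t1 def_t sub1 => [|a' t1] /= def_t sub1.
    by right; apply/contains132P; exists a, b, c; rewrite def_t.
  case/lastP: t2 def_t sub2 => [|t2 b'] def_t sub2.
    by left; apply/contains132P; exists a, b, c; rewrite def_t cats0.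
  have aU : a \in U.
    by rewrite (mem_subseq sub1) //; case: def_t => ->; rewrite inE eqxx.
  have bD : b \in D.
    rewrite (mem_subseq sub2) // mem_rcons.
    have := congr1 (last 0) def_t; rewrite -cat_cons -rcons_cat last_rcons /=.
    by move=> ->; rewrite inE eqxx.
  by have := gt_UD _ _ aU bD => /=; lia.
case=> /contains132P[a [b [c [lt_ab lt_bc sub_s]]]]; apply/contains132P;
  exists a, b, c; split=> //; apply: (subseq_trans sub_s).
  exact: prefix_subseq.
exact: suffix_subseq.
Qed.

(** The last letter of an occurrence is smaller than the middle one, so it is not the maximum
    [d]. *)
Lemma contains132_rcons_max s d :
  all (gtn d) s ->
  contains (rcons s d) [:: 1; 3; 2] = contains s [:: 1; 3; 2].
Proof.
move/allP => lt_sd; apply/contains132P/contains132P => -[a [b [c [lt_ab lt_bc sub_s]]]];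
  exists a, b, c; split=> //; last first.
  exact: (subseq_trans sub_s (subseq_rcons _ _)).
have c_s : c \in rcons s d by rewrite (mem_subseq sub_s) // !inE eqxx orbT.
have b_s : b \in rcons s d by rewrite (mem_subseq sub_s) // !inE eqxx !orbT.
apply: (@subseq_rcons_neq _ [:: a; c] _ _ d) => //.
apply: contraTneq c_s => def_b; rewrite -def_b in lt_sd *.
rewrite mem_rcons inE negb_or gtn_eqF //=; apply/negP => /lt_sd /=; lia.
Qed.

Lemma RLmax_cons x s : RLmax (x :: s) = all (gtn x) s + RLmax s.
Proof.
have RLmaxE t : RLmax t = \sum_(i < size t)
    [forall j : 'I_(size t), (i < j) ==> (nth 0 t j < nth 0 t i)].
  rewrite /RLmax -sum1dep_card big_mkcond /=.
  by apply: eq_bigr => i _; case: ifP.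
rewrite !RLmaxE /= big_ord_recl; congr (nat_of_bool _ + _).
  apply/forallP/(all_nthP 0) => /= [h i lt_i|h [[|i] lt_i] //=].
    exact: (h (Ordinal (lt_i : i.+1 < (size s).+1))).
  exact: h.
apply: eq_bigr => i _; congr nat_of_bool.
apply/forallP/forallP => /= h j; first exact: (h (lift ord0 j)).
by case: j => [[|j] lt_j] //=; apply: (h (Ordinal (lt_j : j < size s))).
Qed.

Lemma RLmax_nil : RLmax [::] = 0.
Proof. by apply: eq_card0 => -[]. Qed.

Lemma RLmax_skew U D : allrel gtn U D -> RLmax (U ++ D) = RLmax U + RLmax D.
Proof.
elim: U => [|x U IHU]; first by rewrite RLmax_nil.
rewrite allrel_consl => /andP[gt_xD gt_UD].
by rewrite /= !RLmax_cons all_cat gt_xD andbT IHU // addnA.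
Qed.

Lemma RLmax_mapS s : RLmax (map S s) = RLmax s.
Proof. by elim: s => //= x s IHs; rewrite !RLmax_cons IHs all_map. Qed.

Lemma RLmax_rcons_max s d : all (gtn d) s -> RLmax (rcons s d) = 1.
Proof.
elim: s => [_|x s IHs /= /andP[lt_xd lt_sd]]; first by rewrite RLmax_cons RLmax_nil.
by rewrite RLmax_cons IHs // all_rcons /= ltnNge (ltnW lt_xd).
Qed.

Lemma RLmax_nth s : RLmax s =
  count (fun i => all (gtn (nth 0 s i)) (drop i.+1 s)) (iota 0 (size s)).
Proof.
elim: s => [|x s IHs]; first by rewrite RLmax_nil.
by rewrite RLmax_cons IHs /= drop0 (iotaDl 1 0) count_map.
Qed.

(** * Skew cuts and appending a last letter *)

Definition skew_cut (s : seq nat) (u : nat) : bool :=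
  allrel gtn (take u s) (drop u s).

Lemma skew_cut0 s : skew_cut s 0.
Proof. by rewrite /skew_cut take0. Qed.

Lemma skew_cut_size s : skew_cut s (size s).
Proof. by rewrite /skew_cut drop_size allrel0r. Qed.

(* Avoiding 132 makes everything before a right-to-left maximum exceed
   everything after it. *)
Lemma RLmax_take_skew_cut s u :
  uniq s -> avoids s [:: 1; 3; 2] -> u <= size s -> skew_cut s u ->
  RLmax (take u s) = count (skew_cut s) (iota 1 u).
Proof.
move=> s_uniq s_av le_u cut_u.
rewrite RLmax_nth size_takel // (iotaDl 1 0) count_map.
apply: eq_in_count => i; rewrite mem_iota add0n => /andP[_ lt_iu] /=.
have lt_i := leq_trans lt_iu le_u.
have def_s : s = take i s ++ nth 0 s i :: drop i.+1 s.
  by rewrite -drop_nth // cat_take_drop.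
have def_drop : drop i.+1 s = drop i.+1 (take u s) ++ drop u s.
  rewrite -[in LHS](cat_take_drop u s) drop_cat size_takel //.
  case: ltnP => // le_ui; have -> : u = i.+1 by lia.
  by rewrite subnn drop0 [drop _ (take _ _)]drop_oversize ?size_takel.
rewrite nth_take // /skew_cut add1n (take_nth 0) // -cats1 allrel_catl allrel1l.
apply/idP/andP => [x_max|[_ x_max]]; last first.
  by move: x_max; rewrite def_drop all_cat => /andP[].
have {}x_max : all (gtn (nth 0 s i)) (drop i.+1 s).
  rewrite def_drop all_cat x_max /=; apply/allP => z z_u.
  apply: (allrelP cut_u) => //; rewrite -(nth_take 0 lt_iu).
  by rewrite mem_nth // size_takel.
split=> //; apply/allrelP => y z y_p z_q /=; rewrite ltnNge; apply/negP => le_yz.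
have neq_yz : y != z.
  move: s_uniq; rewrite def_s cat_uniq => /and3P[_ /hasPn no_dup _].
  by apply: contraTneq y_p => ->; apply: no_dup; rewrite inE z_q orbT.
case/negP: s_av; apply/contains132P; exists y, z, (nth 0 s i); split.
- by rewrite ltn_neqAle neq_yz.
- exact: (allP x_max).
rewrite [X in subseq _ X]def_s -[[:: y; _; _]]/([:: y] ++ [:: nth 0 s i; z]).
by apply: cat_subseq; rewrite ?sub1seq //= eqxx sub1seq.
Qed.

(** The count up to [u] is the rank of [u] among the elements satisfying [q]. Applied to cuts, it
    shows that the right-to-left maxima counts of the upper blocks are consecutive. *)
Lemma map_count_filter q m :
  [seq count q (iota 1 u) | u <- iota 1 m & q u] = iota 1 (count q (iota 1 m)).
Proof.
elim: m => // m IHm; rewrite [in LHS]iota1S filter_cat map_cat IHm.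
have countS : count q (iota 1 m.+1) = count q (iota 1 m) + q m.+1.
  by rewrite iota1S count_cat /= addn0.
rewrite countS [filter q [:: _]]/=; case: ifP => q_m; last by rewrite cats0 addn0.
rewrite addn1 iota1S; congr (_ ++ [:: _]).
by rewrite -/(iota 1 m.+1) countS q_m addn1.
Qed.

(** Both bounds come from counting: a letter of the upper block exceeds the [n - u] distinct letters
    of the lower one, and all values up to a letter of the lower block lie in that block. *)
Lemma skew_cut_perm_bounds n s u :
  perm_eq s (iota 1 n) -> u <= n -> skew_cut s u ->
  all (fun x => n - u < x) (take u s) && all (fun x => x <= n - u) (drop u s).
Proof.
move=> s_perm le_u /allrelP cut_u.
have sz_s : size s = n by rewrite (perm_size s_perm) size_iota.
have mem_s x : (x \in s) = (0 < x <= n).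
  by rewrite (perm_mem s_perm) mem_iota add1n.
have s_uniq : uniq s by rewrite (perm_uniq s_perm) iota_uniq.
have sz_D : size (drop u s) = n - u by rewrite size_drop sz_s.
apply/andP; split; apply/allP => x x_s /=.
  rewrite -sz_D; have -> : (size (drop u s) < x) = (size (drop u s) <= size (iota 1 x.-1)).
    have : 0 < x <= n by rewrite -mem_s (mem_take x_s).
    by rewrite size_iota; lia.
  apply: uniq_leq_size; first exact: drop_uniq.
  move=> y y_D; rewrite mem_iota; have /= := cut_u _ _ x_s y_D.
  have : 0 < y <= n by rewrite -mem_s (mem_drop y_D).
  by lia.
rewrite -sz_D -[leqLHS](size_iota 1); apply: uniq_leq_size (iota_uniq _ _) _.
move=> y; rewrite mem_iota add1n ltnS => /andP[y_gt0 le_yx].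
have : y \in s by rewrite mem_s y_gt0; move: (mem_drop x_s); rewrite mem_s; lia.
rewrite -[in X in X -> _](cat_take_drop u s) mem_cat => /orP[y_U|//].
by have /= := cut_u _ _ y_U x_s; lia.
Qed.

(* The letter appended exceeds exactly the entries of [drop u s] when [u] is a
   skew cut of a permutation. *)
Definition append_at (s : seq nat) (u : nat) : seq nat :=
  map S (take u s) ++ rcons (drop u s) (size s - u).+1.

Lemma append_at_perm n s u :
  perm_eq s (iota 1 n) -> u <= n -> skew_cut s u ->
  [/\ perm_eq (append_at s u) (iota 1 n.+1),
      allrel gtn (map S (take u s)) (rcons (drop u s) (size s - u).+1)
    & all (gtn (size s - u).+1) (drop u s)].
Proof.
move=> s_perm le_u cut_u.
have sz_s : size s = n by rewrite (perm_size s_perm) size_iota.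
have /andP[/allP U_gt /allP D_le] := skew_cut_perm_bounds s_perm le_u cut_u.
have mem_s x : (x \in s) = (0 < x <= n).
  by rewrite (perm_mem s_perm) mem_iota add1n.
have s_uniq : uniq s by rewrite (perm_uniq s_perm) iota_uniq.
have gt_UD : allrel gtn (map S (take u s)) (rcons (drop u s) (size s - u).+1).
  apply/allrelP => _ y /mapP[x /U_gt x_gt ->].
  rewrite mem_rcons inE sz_s => /orP[/eqP ->|/D_le] /=; lia.
have d_max : all (gtn (size s - u).+1) (drop u s).
  by apply/allP => x /D_le; rewrite sz_s.
split=> //.
have new_uniq : uniq (append_at s u).
  rewrite cat_uniq (map_inj_uniq succn_inj) take_uniq // rcons_uniq drop_uniq //.
  rewrite andbT /=; apply/andP; split.
    apply/hasPn => y y_D; apply/negP => y_U.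
    by have /= := allrelP gt_UD _ _ y_U y_D; rewrite ltnn.
  by apply/negP => /(allP d_max) /=; rewrite ltnn.
apply: uniq_perm; rewrite ?iota_uniq //.
have [] // := uniq_min_size new_uniq (s2 := iota 1 n.+1).
  move=> x; rewrite mem_cat mem_rcons inE mem_iota => /or3P[/mapP[y y_U ->]|/eqP->|].
  - by move: (mem_take y_U); rewrite mem_s; lia.
  - by rewrite sz_s; lia.
  - by move/mem_drop; rewrite mem_s; lia.
rewrite size_iota size_cat size_map size_rcons size_takel ?sz_s //.
by rewrite size_drop sz_s; lia.
Qed.

Definition asc_RLmax (s : seq nat) := (asc s, RLmax s).

(** The new letter is the maximum of the lower block and so its only right-to-left maximum. The
    junction of the blocks is a descent before and after, so a new ascent arises just when the lower
    block is nonempty. *)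
Lemma asc_RLmax_append_at n s u :
  perm_eq s (iota 1 n.+1) -> u <= n.+1 -> skew_cut s u ->
  asc_RLmax (append_at s u) = (asc s + (u < n.+1), (RLmax (take u s)).+1).
Proof.
move=> s_perm le_u cut_u.
have [_ gt_UD d_max] := append_at_perm s_perm le_u cut_u.
have sz_s : size s = n.+1 by rewrite (perm_size s_perm) size_iota.
rewrite /asc_RLmax /append_at RLmax_skew // RLmax_mapS RLmax_rcons_max // addn1.
congr (_, _).
have -> : (u < n.+1) = (drop u s != [::]).
  by rewrite -size_eq0 size_drop sz_s subn_eq0 ltnNge.
move: cut_u gt_UD d_max; rewrite /skew_cut sz_s; set d := (_ - _).+1.
rewrite -[in asc s](cat_take_drop u s).
have : take u s ++ drop u s != [::] by rewrite cat_take_drop -size_eq0 sz_s.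
have d_gt0 : 0 < d by [].
move: (take u s) (drop u s) d d_gt0 => [|x U] [|y D] d d_gt0 //= _.
- move=> _ _ lt_Dd; rewrite !asc_cons -cats1 asc_from_cat /=.
  have -> : last y D < d by apply: (allP (a := gtn d) (s := y :: D)) => //; apply: mem_last.
  by rewrite addn0.
- rewrite !asc_cons cats0 => _ gt_UD _.
  rewrite asc_from_cat asc_from_mapS /= last_map.
  have /= := allrelP gt_UD (last x U).+1 d.
  rewrite -map_cons mem_map ?mem_last ?inE ?eqxx; last exact: succn_inj.
  by move=> /(_ isT isT); lia.
move=> cut gt_UD lt_Dd; rewrite !asc_cons !asc_from_cat asc_from_mapS /= last_map.
have lt1 : y < last x U.
  by apply: (allrelP cut); rewrite ?mem_last ?inE ?eqxx.
have lt2 : last y D < d by apply: (allP (a := gtn d) (s := y :: D)) => //; apply: mem_last.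
have -> : ((last x U).+1 < y) = false by lia.
have -> : (last x U < y) = false by lia.
by rewrite -cats1 asc_from_cat /= lt2 !add0n addn0 addnA.
Qed.

(** As for the tree, index [n] means length [n + 1]; the positions [0] and [m + 1] at both ends
    count as cuts. *)
Fixpoint perm132_list (n : nat) : seq (seq nat) :=
  if n is m.+1 then
    [seq append_at s u | s <- perm132_list m,
                         u <- [seq u <- iota 0 m.+2 | skew_cut s u]]
  else [:: [:: 1]].

Lemma perm132_listS n : perm132_list n.+1 =
  [seq append_at s u | s <- perm132_list n,
                       u <- [seq u <- iota 0 n.+2 | skew_cut s u]].
Proof. by []. Qed.

(** Once a letter below [d] has appeared, no letter above [d] can follow. *)
Lemma split_around_pivot s d :
  d \notin s -> (forall a c, a < d -> d < c -> ~~ subseq [:: a; c] s) ->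
  s = filter (ltn d) s ++ filter (gtn d) s.
Proof.
elim: s => //= x s IHs; rewrite inE negb_or => /andP[neq_dx d_s] no_ac.
have {}IHs : s = filter (ltn d) s ++ filter (gtn d) s.
  apply: IHs => // a c lt_ad lt_dc; apply: contra (no_ac a c lt_ad lt_dc) => sub_s.
  exact: (subseq_trans sub_s (subseq_cons s x)).
case: ltngtP neq_dx => //= cmp_dx _; first by rewrite -IHs.
suff no_gt : filter (ltn d) s = [::] by rewrite {1}IHs no_gt.
apply/eqP; rewrite -(negbK (_ == _)) -has_filter; apply/hasPn => c c_s /=.
apply/negP => lt_dc; have := no_ac x c cmp_dx lt_dc.
by rewrite eqxx sub1seq c_s.
Qed.

(** The last letter [d] would be the 2 of a pattern 132 if some smaller letter preceded a larger
    one. So the larger letters come first, and lowering them by one undoes [append_at]. *)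
Lemma perm132_last n s :
  perm_eq s (iota 1 n.+1) -> avoids s [:: 1; 3; 2] ->
  exists t u, [/\ perm_eq t (iota 1 n), u <= n, skew_cut t u & s = append_at t u].
Proof.
move=> s_perm s_av.
have sz_s : size s = n.+1 by rewrite (perm_size s_perm) size_iota.
have mem_s x : (x \in s) = (0 < x <= n.+1).
  by rewrite (perm_mem s_perm) mem_iota add1n.
have s_uniq : uniq s by rewrite (perm_uniq s_perm) iota_uniq.
case/lastP: s sz_s mem_s s_uniq s_av {s_perm} => // r d.
rewrite size_rcons rcons_uniq => -[sz_r] mem_s /andP[d_r r_uniq] s_av.
have d_bound : 0 < d <= n.+1 by rewrite -mem_s mem_rcons inE eqxx.
have mem_r x : x \in r -> 0 < x <= n.+1.
  by move=> x_r; rewrite -mem_s mem_rcons inE x_r orbT.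
have def_r : r = filter (ltn d) r ++ filter (gtn d) r.
  apply: split_around_pivot => // a c lt_ad lt_dc; apply: contra s_av => sub_r.
  apply/contains132P; exists a, d, c; split=> //.
  rewrite -[[:: a; c; d]]/([:: a; c] ++ [:: d]) -cats1.
  by apply: cat_subseq.
move: def_r; set U := filter (ltn d) r; set D := filter (gtn d) r => def_r.
have U_gt x : x \in U -> d < x by rewrite mem_filter => /andP[].
have D_lt x : x \in D -> x < d by rewrite mem_filter => /andP[].
have U_r x : x \in U -> x \in r by rewrite mem_filter => /andP[].
have D_r x : x \in D -> x \in r by rewrite mem_filter => /andP[].
(* [D] consists of the values [1, ..., d-1], so the letter that [append_at] computes from the size
   of [D] is [d]. *)
have sz_D : size D = d.-1.
  rewrite -(size_iota 1 d.-1); apply/perm_size/uniq_perm.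
  - exact: filter_uniq.
  - exact: iota_uniq.
  move=> x; rewrite mem_filter mem_iota /=.
  apply/andP/idP => [[lt_xd /mem_r]|]; first by lia.
  move=> x_bound; split; first by lia.
  have : x \in rcons r d by rewrite mem_s; lia.
  by rewrite mem_rcons inE => /orP[/eqP|//]; lia.
have sz_UD : size U + size D = n by rewrite -size_cat -def_r.
pose t := map predn U ++ D.
have take_t : take (size U) t = map predn U by rewrite take_size_cat // size_map.
have drop_t : drop (size U) t = D by rewrite drop_size_cat // size_map.
have sz_t : size t = n by rewrite size_cat size_map.
have US : map S (map predn U) = U.
  rewrite -map_comp -[RHS]map_id; apply/eq_in_map => x /U_gt /=; lia.
have cut_t : skew_cut t (size U).
  rewrite /skew_cut take_t drop_t; apply/allrelP => _ y /mapP[x /U_gt x_gt ->] /D_lt /=.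
  lia.
exists t, (size U); split=> //; last first.
- rewrite /append_at take_t drop_t US sz_t -rcons_cat -def_r; congr (rcons r _); lia.
- lia.
have t_uniq : uniq t.
  rewrite cat_uniq filter_uniq // andbT; apply/andP; split.
    by rewrite -(map_inj_uniq succn_inj) US filter_uniq.
  apply/hasPn => y /D_lt y_lt; apply/mapP => -[x /U_gt x_gt def_y]; lia.
apply: uniq_perm; rewrite ?iota_uniq //.
have [] // := uniq_min_size t_uniq (s2 := iota 1 n); last by rewrite size_iota sz_t.
move=> x; rewrite mem_cat mem_iota => /orP[/mapP[y y_U ->]|x_D].
  by have := U_gt y y_U; have := mem_r y (U_r y y_U); lia.
by have := D_lt x x_D; have := mem_r x (D_r x x_D); lia.
Qed.

Lemma mem_perm132_list n s :
  (s \in perm132_list n) =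
    perm_eq s (iota 1 n.+1) && avoids s [:: 1; 3; 2].
Proof.
elim: n s => [|n IHn] s.
  rewrite inE; apply/eqP/andP => [->|[s_perm _]].
    by split=> //; apply/contains132P => -[a [b [c [_ _]]]] /size_subseq.
  by apply: perm_small_eq => //; rewrite perm_sym.
rewrite perm132_listS; apply/allpairsPdep/andP => [[t [u [t_in]]]|].
  rewrite mem_filter mem_iota => /andP[cut_u le_u] ->.
  move: t_in; rewrite IHn => /andP[t_perm t_av].
  have {}le_u : u <= n.+1 by lia.
  have [new_perm gt_UD d_max] := append_at_perm t_perm le_u cut_u.
  split=> //; rewrite /avoids contains132_skew // contains132_mapS.
  by rewrite contains132_rcons_max // -contains132_skew // cat_take_drop.
case=> s_perm s_av.
have [t [u [t_perm le_u cut_u def_s]]] := perm132_last s_perm s_av.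
have [_ gt_UD d_max] := append_at_perm t_perm le_u cut_u.
exists t, u; split=> //; last first.
  by rewrite mem_filter cut_u mem_iota; lia.
rewrite IHn t_perm; move: s_av; rewrite def_s /avoids contains132_skew //.
rewrite contains132_mapS contains132_rcons_max // -contains132_skew //.
by rewrite cat_take_drop.
Qed.

(** The last letter of [append_at s u] determines [u], and then both blocks of [s] can be read
    off. *)
Lemma perm132_list_uniq n : uniq (perm132_list n).
Proof.
elim: n => // n IHn; rewrite perm132_listS; apply: allpairs_uniq_dep => // [s _|].
  by rewrite filter_uniq // iota_uniq.
move=> x1 x2 /allpairsPdep[s1 [u1 [s1_in u1_in ->]]].
case/allpairsPdep=> s2 [u2 [s2_in u2_in ->]] /=.
have sz s : s \in perm132_list n -> size s = n.+1.
  by rewrite mem_perm132_list => /andP[/perm_size-> _]; rewrite size_iota.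
move: u1_in u2_in; rewrite !mem_filter !mem_iota => /andP[_ u1_le] /andP[_ u2_le].
rewrite /append_at (sz _ s1_in) (sz _ s2_in) -!rcons_cat => /rcons_inj[eq_s eq_u].
have {}eq_u : u1 = u2 by lia.
rewrite {}eq_u in eq_s *.
move/eqP: eq_s; rewrite eqseq_cat; last by rewrite !size_map !size_take !sz.
case/andP=> /eqP/(inj_map succn_inj) eq_take /eqP eq_drop.
suff -> : s1 = s2 by [].
by rewrite -(cat_take_drop u2 s1) eq_take eq_drop cat_take_drop.
Qed.

(** With label [(k, h)], the cut [0] gives [(k+1, 1)], the [h - 1] interior cuts give
    [(k+1, 2), ..., (k+1, h)], and the cut at the end gives [(k, h+1)]. *)
Lemma perm_asc_RLmax_children n s :
  perm_eq s (iota 1 n.+1) -> avoids s [:: 1; 3; 2] ->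
  perm_eq [seq asc_RLmax (append_at s u) | u <- iota 0 n.+2 & skew_cut s u]
    ((asc s, (RLmax s).+1) :: ascending_children (asc_RLmax s)).
Proof.
move=> s_perm s_av.
have sz_s : size s = n.+1 by rewrite (perm_size s_perm) size_iota.
have s_uniq : uniq s by rewrite (perm_uniq s_perm) iota_uniq.
have take_s : take n.+1 s = s by rewrite -sz_s take_size.
have cut_s : skew_cut s n.+1 by rewrite -sz_s skew_cut_size.
have -> : [seq asc_RLmax (append_at s u) | u <- iota 0 n.+2 & skew_cut s u] =
  [seq (asc s + (u < n.+1), (RLmax (take u s)).+1) | u <- iota 0 n.+2 & skew_cut s u].
  apply/eq_in_map => u; rewrite mem_filter mem_iota => /andP[cut_u le_u].
  by apply: asc_RLmax_append_at => //; lia.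
have iotaE : iota 0 n.+2 = 0 :: (iota 1 n ++ [:: n.+1]) by rewrite -iota1S.
rewrite iotaE /= skew_cut0 /= filter_cat map_cat /= cut_s /= ltnn addn0 take_s.
rewrite take0 RLmax_nil -cat_cons cats1 perm_rcons perm_cons /ascending_children /=.
have -> : RLmax s = (count (skew_cut s) (iota 1 n)).+1.
  rewrite -[in LHS]take_s RLmax_take_skew_cut ?sz_s // iota1S count_cat /= cut_s.
  by rewrite addn1.
rewrite addn1 /= perm_cons (iotaDl 1 1) -map_comp.
rewrite -map_count_filter -map_comp.
set l := map _ _; set l' := map _ _; suff -> : l = l' by [].
apply/eq_in_map => u; rewrite mem_filter mem_iota => /andP[cut_u le_u] /=.
by rewrite RLmax_take_skew_cut // ?sz_s ?addn1 //; [congr (_, _) | ]; lia.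
Qed.

Lemma perm_asc_RLmax_catalan_tree n :
  perm_eq (map asc_RLmax (perm132_list n)) (catalan_tree n).
Proof.
elim: n => [|n IHn]; first by rewrite /= /asc_RLmax RLmax_cons RLmax_nil asc_cons.
rewrite perm132_listS; apply: perm_trans (perm_flatten_map _ IHn).
rewrite map_flatten -!map_comp; apply/seq.permP => a; rewrite !count_flatten_map.
apply: eq_big_seq => s; rewrite mem_perm132_list => /andP[s_perm s_av] /=.
by rewrite -map_comp; move/seq.permP: (perm_asc_RLmax_children s_perm s_av); apply.
Qed.

(** * Narayana numbers *)

Import GRing.Theory.

Definition tail_count (n k l : nat) : nat :=
  count (fun kh => (kh.1 == k) && (l <= kh.2)) (catalan_tree n).

Lemma count_leq_iota1 l h : count (leq l.+1) (iota 1 h) = h - l.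
Proof.
elim: h => // h IHh; rewrite iota1S count_cat IHh /= addn0 ltnS.
by case: leqP; lia.
Qed.

Lemma catalan_tree_bounds n kh : kh \in catalan_tree n -> 0 < kh.2 <= n.+1.
Proof.
elim: n kh => [|n IHn] kh /=; first by rewrite inE => /eqP->.
case/flattenP => _ /mapP[[a h] /IHn /andP[/= h_gt0 h_le] ->]; rewrite inE.
case/orP => [/eqP-> //|/mapP[j]].
by rewrite mem_iota => /= j_bound -> /=; lia.
Qed.

Lemma tail_count0 n k : tail_count n k 0 = tail_count n k 1.
Proof.
by apply: eq_in_count => kh /catalan_tree_bounds/andP[-> _].
Qed.

Lemma tail_count_oversize n k l : n.+1 < l -> tail_count n k l = 0.
Proof.
move=> lt_nl; rewrite /tail_count -(count_pred0 (catalan_tree n)).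
apply: eq_in_count => kh /catalan_tree_bounds/andP[_ h_le] /=.
by rewrite [l <= _]leqNgt (leq_ltn_trans h_le) ?andbF.
Qed.

(** A node [(a, h)] has one child with [a] ascents, and [h - l] (truncated) ascending children with
    second entry above [l]. *)
Lemma tail_countS n k l :
  tail_count n.+1 k l.+1 =
    \sum_(kh <- catalan_tree n)
       (((kh.1 == k) && (l <= kh.2)) + (kh.1.+1 == k) * (kh.2 - l)).
Proof.
rewrite /tail_count /= count_flatten_map; apply: eq_bigr => -[a h] _ /=.
rewrite ltnS /ascending_children /= count_map; congr (_ + _).
rewrite -count_leq_iota1; case: eqP => [->|neq_ak] /=.
  by rewrite mul1n; apply: eq_count => j /=; rewrite eqxx.
apply/eqP; rewrite mul0n -leqn0 leqNgt -has_count; apply/hasPn => j _ /=.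
by case: eqP neq_ak.
Qed.

(** Differencing the previous formula in [l] turns the weight [h - l] into the indicator of [l < h],
    which again defines a tail. Terms are placed so that no subtraction occurs. *)
Lemma tail_count_rec n k l :
  tail_count n.+1 k.+1 l.+1 + tail_count n k.+1 l.+1 =
    tail_count n.+1 k.+1 l.+2 + tail_count n k.+1 l + tail_count n k l.+1.
Proof.
rewrite !tail_countS /tail_count !count_big -!big_split /=.
apply: eq_bigr => -[a h] _ /=; rewrite eqSS.
by case: (eqVneq a k.+1); case: (eqVneq a k); lia.
Qed.

Lemma tail_count_rec0 n l :
  tail_count n.+1 0 l.+1 + tail_count n 0 l.+1 =
    tail_count n.+1 0 l.+2 + tail_count n 0 l.
Proof.
rewrite !tail_countS /tail_count !count_big -!big_split /=.
by apply: eq_bigr => -[a h] _ /=; lia.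
Qed.

Local Open Scope ring_scope.

(** For [k > r] the truncated and the rational difference disagree, but the binomial coefficient
    vanishes. *)
Lemma mul_bin_left_rat r k :
  k.+1%:R * 'C(r, k.+1)%:R = (r%:R - k%:R) * 'C(r, k)%:R :> rat.
Proof.
rewrite -natrM mul_bin_left natrM; case: (leqP k r) => [le_kr|lt_rk].
  by rewrite natrB.
by rewrite bin_small // !mulr0.
Qed.

(* Closed form of [tail_count n.-1 k l]. *)
Definition tail_value (n k l : nat) : rat :=
  'C(n, k)%:R * (l%:R * 'C(n - l, k)%:R + 'C(n - l, k.+1)%:R) / n%:R.

(** Writing [n] as [r + l + 1] removes truncated subtraction. Pascal's rule reduces the upper
    indices to [r] and [n], and expressing ['C(r, k+1)] and ['C(n, k+1)] through lower index [k]
    leaves a rational identity. *)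
Lemma tail_value_rec r l k : let n := (r + l.+1)%N in
  tail_value n.+1 k.+1 l.+1 =
    tail_value n.+1 k.+1 l.+2 + tail_value n k.+1 l - tail_value n k.+1 l.+1
    + tail_value n k l.+1.
Proof.
move=> n; rewrite /tail_value.
have -> : (n.+1 - l.+1 = r.+1)%N by lia.
have -> : (n.+1 - l.+2 = r)%N by lia.
have -> : (n - l = r.+1)%N by lia.
have -> : (n - l.+1 = r)%N by lia.
rewrite !binS !natrD.
have k_neq0 : k.+1%:R != 0 :> rat by rewrite Num.Theory.pnatr_eq0.
have n_neq0 : n%:R != 0 :> rat by rewrite Num.Theory.pnatr_eq0; lia.
have n1_neq0 : n.+1%:R != 0 :> rat by rewrite Num.Theory.pnatr_eq0.
have binr : 'C(r, k.+1)%:R = (r%:R - k%:R) * 'C(r, k)%:R / k.+1%:R :> rat.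
  by rewrite -mul_bin_left_rat mulrC mulKf.
have binn : 'C(n, k.+1)%:R = (n%:R - k%:R) * 'C(n, k)%:R / k.+1%:R :> rat.
  by rewrite -mul_bin_left_rat mulrC mulKf.
rewrite binr binn; move: k_neq0 n_neq0 n1_neq0.
rewrite -[l.+2%:R]natr1 -[l.+1%:R]natr1 -[k.+1%:R]natr1 -[n.+1%:R]natr1 natrD -[l.+1%:R]natr1.
by move=> *; field; apply/and3P.
Qed.

Lemma tail_value_rec0 r l : let n := (r + l.+1)%N in
  tail_value n.+1 0 l.+1 =
    tail_value n.+1 0 l.+2 + tail_value n 0 l - tail_value n 0 l.+1.
Proof.
move=> n; rewrite /tail_value.
have -> : (n.+1 - l.+1 = r.+1)%N by lia.
have -> : (n.+1 - l.+2 = r)%N by lia.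
have -> : (n - l = r.+1)%N by lia.
have -> : (n - l.+1 = r)%N by lia.
rewrite !bin0 !bin1 -[l.+2%:R]natr1 -[l.+1%:R]natr1 -[r.+1%:R]natr1; ring.
Qed.

Lemma tail_value_diag n k : tail_value n.+1 k n.+1 = (k == 0%N)%:R.
Proof.
rewrite /tail_value subnn; case: k => [|k].
  by rewrite !bin0 addr0 mulr1 mul1r divff // Num.Theory.pnatr_eq0.
by rewrite !bin0n /= mulr0 addr0 mulr0 mul0r.
Qed.

Lemma tail_countE n k l : (l <= n.+1)%N -> (tail_count n k l)%:R = tail_value n.+1 k l.
Proof.
elim: n k l => [|n IHn] k l.
  move=> le_l; have -> : tail_count 0 k l = (k == 0%N).
    by rewrite /tail_count /= addn0 eq_sym le_l andbT.
  case: l le_l => [|[|l]] // _; last by rewrite tail_value_diag.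
  by rewrite -(tail_value_diag 0) /tail_value subn0 subnn; case: k => [|[|k]];
    rewrite /= !bin0n ?bin1 ?binS ?bin0n /=; ring.
move: k.
(* The recurrence yields the value at [l] from the one at [l + 1], so within a level [l] descends
   from its maximum [n + 2], and [m] is the distance from it. *)
have step m k : (m <= n.+1)%N ->
    (tail_count n.+1 k (n.+2 - m))%:R = tail_value n.+2 k (n.+2 - m).
  elim: m k => [|m IHm] k.
    move=> _; rewrite subn0 tail_value_diag.
    (* At the top, every other term of the recurrence lies beyond the largest second entry of its
       level. *)
    have top0 : tail_count n.+1 k n.+2 = tail_count n k n.+1.
      have := tail_count_oversize k (ltnSn n.+2).
      have := tail_count_oversize k (ltnSn n.+1).
      case: k => [|k]; first by have := tail_count_rec0 n n.+1; lia.
      have := tail_count_oversize k (ltnSn n.+1).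
      by have := tail_count_rec n k n.+1; lia.
    by rewrite top0 IHn // tail_value_diag.
  move=> lt_m; have {IHm} IHm k' := IHm k' (ltnW lt_m).
  pose j := (n - m)%N.
  have def_j : (n.+2 - m.+1)%N = j.+1 by rewrite /j; lia.
  have def_j1 : (n.+2 - m)%N = j.+2 by rewrite /j; lia.
  rewrite def_j; rewrite def_j1 in IHm.
  have def_n : n.+1 = (m + j.+1)%N by rewrite /j; lia.
  have le_j : (j.+1 <= n.+1)%N by rewrite /j; lia.
  case: k => [|k].
    have := congr1 (fun x : nat => x%:R : rat) (tail_count_rec0 n j).
    rewrite /= !natrD IHm !IHn ?(ltnW le_j) // => /eqP.
    by rewrite eq_sym -subr_eq eq_sym => /eqP->; rewrite def_n tail_value_rec0.
  have := congr1 (fun x : nat => x%:R : rat) (tail_count_rec n k j).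
  rewrite /= !natrD IHm !IHn ?(ltnW le_j) // => /eqP.
  rewrite eq_sym -subr_eq eq_sym => /eqP->; rewrite def_n tail_value_rec; ring.
case: l => [|l] k; last first.
  move=> lt_l; have := step (n.+1 - l)%N k.
  by have -> : (n.+2 - (n.+1 - l) = l.+1)%N; [lia | apply; lia].
(* The recurrence stops at [l = 1]. The tail for [l = 0] is the same, and the two closed forms agree
   by Pascal's rule. *)
move=> _; rewrite tail_count0; have := step n.+1 k (leqnn _); rewrite subSn // subnn => ->.
by rewrite /tail_value subn0 subn1 /= mul0r add0r mul1r (binS n.+1 k) natrD addrC.
Qed.

Lemma count_asc_catalan_tree n k :
  (count (fun kh => kh.1 == k) (catalan_tree n))%:R = narayana n.+1 k.+1.
Proof.
have -> : count (fun kh => kh.1 == k) (catalan_tree n) = tail_count n k 0.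
  by apply: eq_in_count => kh _; rewrite leq0n andbT.
rewrite tail_countE // /tail_value /narayana subn0 mul0r add0r.
by rewrite mulrC mulrA mulrAC.
Qed.

Close Scope ring_scope.

(** * From words to tuples and permutations *)

(** Common bridge for both families: [w] is the word of a tuple or of a permutation, and [L] is the
    generated list. *)
Lemma card_count (T : finType) (X : {set T}) (w : T -> seq nat) (L : seq (seq nat))
    (P : pred (seq nat)) :
  injective w -> uniq L ->
  (forall s, reflect (exists2 x, x \in X & w x = s) (s \in L)) ->
  #|[set x in X | P (w x)]| = count P L.
Proof.
move=> w_inj L_uniq memL.
have perm_L : perm_eq (map w (enum X)) L.
  apply: uniq_perm => // [|s]; first by rewrite map_inj_uniq ?enum_uniq.
  apply/mapP/memL => -[x x_X]; first by move=> ->; exists x; rewrite // -mem_enum.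
  by move=> <-; exists x; rewrite ?mem_enum.
rewrite -(seq.permP perm_L) count_map cardE -size_filter; congr size.
rewrite /enum_mem -filter_predI; apply: eq_filter => x.
by rewrite !inE andbC.
Qed.

Lemma mem_ascent0012_word n (s : seq nat) :
  reflect (exists2 x : n.+1.-tuple 'I_n.+1,
             x \in avoiding_ascent_seqs [:: 0; 0; 1; 2] n.+1 & word x = s)
          (s \in (ascent0012_lists n).1).
Proof.
rewrite (mem_ascent0012_lists n s).1.
apply: (iffP and3P) => [[/eqP sz_s s_asc s_av]|[x]].
  have := ascent_seq_word s_asc; rewrite sz_s => -[x def_x].
  by exists x; rewrite ?inE def_x ?s_asc.
by rewrite inE => /andP[x_asc x_av] <-; rewrite size_map size_tuple.
Qed.

Lemma perm_word_inj n : injective (@perm_word n).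
Proof.
move=> sigma tau eq_w; apply/permP => i; apply/val_inj/succn_inj.
by move/eq_in_map: eq_w => /(_ i); apply; rewrite mem_enum.
Qed.

Lemma perm_word_perm_iota n (sigma : 'S_n) : perm_eq (perm_word sigma) (iota 1 n).
Proof.
have w_uniq : uniq (perm_word sigma).
  by rewrite map_inj_uniq ?enum_uniq // => i j [/val_inj/perm_inj].
apply: uniq_perm; rewrite ?iota_uniq //.
have [] // := uniq_min_size w_uniq (s2 := iota 1 n).
  by move=> x /mapP[i _ ->]; rewrite mem_iota add1n !ltnS /=.
by rewrite size_iota size_map size_enum_ord.
Qed.

Lemma perm_iota_perm_word n s :
  perm_eq s (iota 1 n) -> exists sigma : 'S_n, perm_word sigma = s.
Proof.
move=> s_perm.
have sz_s : size s = n by rewrite (perm_size s_perm) size_iota.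
have s_uniq : uniq s by rewrite (perm_uniq s_perm) iota_uniq.
have nth_s i : i < n -> 0 < nth 0 s i <= n.
  move=> lt_i; have : nth 0 s i \in s by rewrite mem_nth ?sz_s.
  by rewrite (perm_mem s_perm) mem_iota add1n.
have lt_n (i : 'I_n) : (nth 0 s i).-1 < n.
  by have := nth_s i (ltn_ord i); lia.
pose f i := Ordinal (lt_n i).
have f_inj : injective f.
  move=> i j /(congr1 val) /= eq_f; apply/val_inj/eqP => /=.
  rewrite -(nth_uniq 0 _ _ s_uniq) ?sz_s //; apply/eqP.
  have /andP[i_gt0 _] := nth_s i (ltn_ord i).
  have /andP[j_gt0 _] := nth_s j (ltn_ord j).
  by rewrite -(prednK i_gt0) -(prednK j_gt0) eq_f.
exists (perm f_inj); apply: (@eq_from_nth _ 0).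
  by rewrite size_map size_enum_ord.
move=> i; rewrite size_map size_enum_ord => lt_i.
rewrite (@nth_map _ (Ordinal lt_i) _ 0 (fun i => (val (perm f_inj i)).+1) i
  (enum 'I_n)) ?size_enum_ord // permE /=.
by rewrite nth_enum_ord // prednK //; case/andP: (nth_s i lt_i).
Qed.

Lemma mem_perm132_word n (s : seq nat) :
  reflect (exists2 sigma : 'S_n.+1,
             sigma \in avoiding_perms [:: 1; 3; 2] n.+1 & perm_word sigma = s)
          (s \in perm132_list n).
Proof.
rewrite mem_perm132_list; apply: (iffP andP) => [[s_perm s_av]|[sigma]].
  have [sigma def_s] := perm_iota_perm_word s_perm.
  by exists sigma; rewrite // inE def_s.
by rewrite inE => sigma_av <-; rewrite perm_word_perm_iota.
Qed.

Theorem theorem2 (n : nat) (n_ge1 : 1 <= n) :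
  (forall k l : int,
     #|[set x in avoiding_ascent_seqs [:: 0; 0; 1; 2] n |
         (Posz (asc (word x)) == k) && (Posz (fwd (word x)) == l)]|
     = #|[set sigma in avoiding_perms [:: 1; 3; 2] n |
         (Posz (asc (perm_word sigma)) == k) &&
         (Posz (RLmax (perm_word sigma)) == l)]|)
  /\
  (forall k : nat,
     (#|[set x in avoiding_ascent_seqs [:: 0; 0; 1; 2] n |
          asc (word x) == k]|%N%:R)%R = narayana n k.+1).
Proof.
case: n n_ge1 => // n _.
have /andP[A_uniq _] := ascent0012_lists_uniq n.
have countA P := card_count P (@word_inj n.+1) A_uniq (@mem_ascent0012_word n).
have countP P := card_count P (@perm_word_inj n.+1) (perm132_list_uniq n)
                   (@mem_perm132_word n).
split=> [k l|k].
  (* As a predicate on labels, the condition handles all integers [k] and [l] at once, negative ones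
     included. *)
  pose kl_pred (kh : nat * nat) := (Posz kh.1 == k) && (Posz kh.2 == l).
  rewrite (countA (preim asc_fwd kl_pred)) (countP (preim asc_RLmax kl_pred)).
  rewrite -!count_map (seq.permP (perm_asc_fwd_catalan_tree n)).
  by rewrite (seq.permP (perm_asc_RLmax_catalan_tree n)).
rewrite (countA (preim asc_fwd (fun kh => kh.1 == k))) -count_map.
by rewrite (seq.permP (perm_asc_fwd_catalan_tree n)) count_asc_catalan_tree.
Qed.
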